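(* Let $n,k$ be positive integers such that $n$ is exactly divisible by $k$, let $\{\mathcal{N}_j\}_{j\in[k]}$ be a partition of $[n]$ into $k$ disjoint folds each of cardinality $n/k$, and fix a hyperparameter vector $\bm{\theta}\in\Theta$. Suppose the training data $(\bm{x}_i,y_i)_{i\in[n]}$ are drawn i.i.d. from an unknown distribution $\mathcal{D}$ on $\mathcal{X}\times\mathcal{Y}$ such that the loss bound $M$ and the hypothesis stability $\mu_h$ are finite constants. Then, for every $\delta\in(0,1)$, with probability at least $1-\delta$ (over the draw of the training sample and any fold-partition randomness), $$\mathbb{E}_{(\bm{x},y)\sim\mathcal{D}}\big[\ell(y,\beta(\bm{\theta},\bm{x}))\big]\ \le\ \frac{1}{n}\sum_{j\in[k]}h_j(\bm{\theta})+\sqrt{\frac{M^2+6Mk\mu_h}{2k\delta}}.$$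
   Context: Setting: $\mathcal{X}\subseteq\mathbb{R}^p$, $\mathcal{Y}\subseteq\mathbb{R}$, and $\ell:\mathcal{Y}\times\mathcal{Y}\to\mathbb{R}_+$ is a nonnegative loss function. The training sample is $\mathcal{S}=(\bm{x}_i,y_i)_{i\in[n]}$, with $[n]=\{1,\dots,n\}$. The partition $\{\mathcal{N}_j\}_{j\in[k]}$ is deterministic, or random but independent of the data. $\Theta$ is the set of hyperparameter combinations. For $\bm{\theta}\in\Theta$, a learning algorithm maps a training data set to a (unique) predictor $\mathcal{X}\to\mathcal{Y}$. The predictor $\beta(\bm{\theta},\cdot)$ is the one obtained from the full sample $\mathcal{S}$, and, for $j\in[k]$, $\beta^{(\mathcal{N}_j)}(\bm{\theta},\cdot)$ is the one obtained from the data $(\bm{x}_i,y_i)_{i\in[n]\setminus\mathcal{N}_j}$, i.e. with fold $\mathcal{N}_j$ omitted. The $j$th partial $k$-fold cross-validation error is $$h_j(\bm{\theta})=\sum_{i\in\mathcal{N}_j}\ell\big(y_i,\beta^{(\mathcal{N}_j)}(\bm{\theta},\bm{x}_i)\big),$$ so that $\frac1n\sum_{j\in[k]}h_j(\bm{\theta})$ is the $k$-fold cross-validation error. $M$ is an upper bound on the loss of any model produced by the learning algorithm (including models trained with a fold omitted) at any data point $(\bm{x},y)\in\mathcal{X}\times\mathcal{Y}$, i.e. all losses lie in $[0,M]$. The hypothesis stability is $$\mu_h=\max_{j\in[k]}\ \mathbb{E}_{\mathcal{S}}\,\mathbb{E}_{(\bm{x},y)\sim\mathcal{D}}\Big|\ell\big(y,\beta^{(\mathcal{N}_j)}(\bm{\theta},\bm{x})\big)-\ell\big(y,\beta(\bm{\theta},\bm{x})\big)\Big|,$$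 where the outer expectation is over the training sample $\mathcal{S}$ of $n$ i.i.d. points from $\mathcal{D}$ (and any fold-split randomness), and $(\bm{x},y)\sim\mathcal{D}$ is drawn independently of $\mathcal{S}$. In the claim, the left-hand expectation is over a fresh point $(\bm{x},y)\sim\mathcal{D}$ independent of the training sample, conditionally on the training sample (so it is a random variable depending on $\mathcal{S}$). *)

(* Defs.v *)
From HB Require Import structures.
From mathcomp Require Import all_boot all_order all_algebra.
From mathcomp Require Import all_classical all_reals all_analysis.

Set Implicit Arguments.
Unset Strict Implicit.
Unset Printing Implicit Defensive.

Import Order.TTheory GRing.Theory Num.Theory.

Local Open Scope classical_set_scope.
Local Open Scope ring_scope.

(* A nonempty subset A of a measurable space T, as a space of its own: the
   type of the points of A with the trace sigma-algebra.  The proof of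
   nonemptiness is an index because MathComp-Analysis requires measurable
   types to be pointed. *)
Definition subspace_of (T : choiceType) (A : set T) (A0 : A !=set0) : Type :=
  set_type A.

Section subspace_of.
Context {d : measure_display} {T : measurableType d}.
Variables (A : set T) (A0 : A !=set0).

HB.instance Definition _ := Choice.on (subspace_of A0).

Let point_of : subspace_of A0 := SigSub (mem_set (projT2 (cid A0))).

HB.instance Definition _ := isPointed.Build (subspace_of A0) point_of.

Definition subspace_val : subspace_of A0 -> T := @set_val T A.

HB.instance Definition _ := Measurable.copy (subspace_of A0)
  (g_sigma_algebra_preimageType subspace_val).

End subspace_of.

Section learning.
Context {R : realType} {dX dY : measure_display}.
Context {X : measurableType dX} {Y : measurableType dY} {Theta : Type}.

(* A training data set is a finite list of labelled points.  The algorithm may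
   depend on the order of the list, so no symmetry is assumed. *)
Definition learning_algorithm := Theta -> seq (X * Y) -> X -> Y.

(* The data with the fold N left out, in the original order. *)
Definition omit_fold n (S : n.-tuple (X * Y)) (N : {set 'I_n}) : seq (X * Y) :=
  [seq tnth S i | i <- enum (~: N)].

Definition equal_partition n k (N : {ffun 'I_k -> {set 'I_n}}) : Prop :=
  [/\ forall j l : 'I_k, j != l -> (N j :&: N l = finset.set0)%SET,
      forall i : 'I_n, exists j, i \in N j
    & forall j, #|N j| = (n %/ k)%N].

Variables (loss : Y -> Y -> R) (A : learning_algorithm) (theta : Theta).

Definition partial_cv_error n k (S : n.-tuple (X * Y))
    (N : {ffun 'I_k -> {set 'I_n}}) (j : 'I_k) : R :=
  \sum_(i in N j)
    loss (tnth S i).2 (A theta (omit_fold S (N j)) (tnth S i).1).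

(* The sizes of the training sets in play: the whole sample, or the sample
   without one fold. *)
Definition training_sizes (n k : nat) : seq nat := [:: n; n - n %/ k]%N.

Definition is_loss_bound (n k : nat) (M : R) : Prop :=
  forall s : seq (X * Y), size s \in training_sizes n k ->
  forall (x : X) (y : Y), loss y (A theta s x) <= M.

(* Joint measurability, in the training set and in the test point, of the loss
   of the trained model; without it the expectations below make no sense. *)
Definition measurable_trained_loss (n k : nat) : Prop :=
  forall m, m \in training_sizes n k ->
  measurable_fun [set: m.-tuple (X * Y) * (X * Y)]
    (fun sz : m.-tuple (X * Y) * (X * Y) =>
       loss sz.2.2 (A theta sz.1 sz.2.1)).

Section sampling.
Context {dO : measure_display} {Omega : measurableType dO}.
Variables (P : probability Omega R) (D : probability (X * Y)%type R).
Variables (n k : nat).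

Definition sample (Z : 'I_n -> {mfun Omega >-> (X * Y)%type}) (w : Omega)
  : n.-tuple (X * Y) := [tuple Z i w | i < n].

Definition iid (Z : 'I_n -> {mfun Omega >-> (X * Y)%type}) : Prop :=
  (forall i B, measurable B -> P (Z i @^-1` B) = D B) /\
  (forall (J : {set 'I_n}) (B : 'I_n -> set (X * Y)),
     (forall i, measurable (B i)) ->
     P (\bigcap_(i in [set` J]) (Z i @^-1` B i))
     = (\prod_(i in J) P (Z i @^-1` B i))%E).

(* A random partition independent of the sample; a deterministic partition is
   the case of a constant N. *)
Definition random_equal_partition
    (Z : 'I_n -> {mfun Omega >-> (X * Y)%type})
    (N : Omega -> {ffun 'I_k -> {set 'I_n}}) : Prop :=
  [/\ forall w, equal_partition (N w),
      forall q, measurable (N @^-1` [set q])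
    & forall q (E : set (n.-tuple (X * Y))), measurable E ->
      P ((N @^-1` [set q]) `&` (sample Z @^-1` E))
      = (P (N @^-1` [set q]) * P (sample Z @^-1` E))%E].

Definition hypothesis_stability
    (Z : 'I_n -> {mfun Omega >-> (X * Y)%type})
    (N : Omega -> {ffun 'I_k -> {set 'I_n}}) : \bar R :=
  (\big[maxe/-oo]_(j < k)
     \int[P]_w \int[D]_z
       `| loss z.2 (A theta (omit_fold (sample Z w) (N w j)) z.1)
          - loss z.2 (A theta (sample Z w) z.1) |%:E)%E.

End sampling.
End learning.

Arguments learning_algorithm {dX dY} X Y Theta.

(* Main.v *)
(* A variant of the second moment bound of Bousquet and Elisseeff.  Fix the
   partition; let r be the risk of the full predictor, r_j the risk of the one
   trained without fold j, and u_i = l_j(z_i) - r_j the centered loss at a point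
   i of fold j.  The gap between risk and cross-validation error is the average
   over i of (r - r_j) - u_i, with j the fold of i.

   For i and i' in distinct folds j and l, both u_i and u_i' are centered given
   all other points, which makes E[u_i u_i'] at most half the mean square of the
   difference of the two centered losses at a common fresh point; going through
   the centered loss of the full predictor, this is at most V2_j + V2_l, where
   V2_j is its mean square distance to the centered loss for fold j.  As V2_j
   and V1_j = E(r - r_j)^2 add up to at most M times the instability of fold j,
   the second moment of the gap is at most 3 M mu_h + 3 M^2 / (8 k).  Markov's
   inequality concludes; a random partition is handled by conditioning. *)
Require Import Defs.
From HB Require Import structures.
From mathcomp Require Import all_boot all_order all_algebra.
From mathcomp Require Import all_classical all_reals all_analysis.
From mathcomp Require Import measurable_realfun lra ring.

Set Implicit Arguments.
Unset Strict Implicit.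
Unset Printing Implicit Defensive.

Import Order.TTheory GRing.Theory Num.Theory.
Import numFieldNormedType.Exports.

Local Open Scope classical_set_scope.
Local Open Scope ring_scope.

(** * Means of bounded measurable functions *)

(** On a probability space such functions are integrable, and they are closed under sums, products,
    sections and partial means, so this one predicate discharges the integrability side conditions
    below. *)
Definition bounded_measurable d (T : measurableType d) (R : realType)
    (f : T -> R) : Prop :=
  measurable_fun [set: T] f /\ exists C : R, forall x, `|f x| <= C.

Section bounded_measurable.
Context {d} {T : measurableType d} {R : realType}.
Implicit Types f g : T -> R.

Lemma bounded_measurable_cst (c : R) :
  bounded_measurable (fun _ : T => c).
Proof. by split=> //; exists `|c|. Qed.

Lemma bounded_measurableD f g : bounded_measurable f -> bounded_measurable g ->
  bounded_measurable (fun x => f x + g x).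
Proof.
move=> [mf [C fC]] [mg [C' gC']]; split; first exact: measurable_funD.
by exists (C + C') => x; rewrite (le_trans (ler_normD _ _)) ?lerD.
Qed.

Lemma bounded_measurableM f g : bounded_measurable f -> bounded_measurable g ->
  bounded_measurable (fun x => f x * g x).
Proof.
move=> [mf [C fC]] [mg [C' gC']]; split; first exact: measurable_funM.
by exists (C * C') => x; rewrite normrM ler_pM.
Qed.

Lemma bounded_measurableB f g : bounded_measurable f -> bounded_measurable g ->
  bounded_measurable (fun x => f x - g x).
Proof.
move=> [mf [C fC]] [mg [C' gC']]; split; first exact: measurable_funB.
by exists (C + C') => x; rewrite (le_trans (ler_normB _ _)) ?lerD.
Qed.

Lemma bounded_measurable_norm f : bounded_measurable f ->
  bounded_measurable (fun x => `|f x|).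
Proof.
move=> [mf [C fC]]; split; first exact: measurableT_comp.
by exists C => x; rewrite normr_id.
Qed.

Lemma bounded_measurableX f n : bounded_measurable f ->
  bounded_measurable (fun x => f x ^+ n).
Proof.
move=> mf; elim: n => [|n IHn]; first exact: bounded_measurable_cst.
by under eq_fun do rewrite exprS; exact: bounded_measurableM.
Qed.

Lemma bounded_measurable_sum (I : Type) (s : seq I) (P : pred I)
    (F : I -> T -> R) : (forall i, bounded_measurable (F i)) ->
  bounded_measurable (fun x => \sum_(i <- s | P i) F i x).
Proof.
move=> mF; elim: s => [|i s IHs].
  by under eq_fun do rewrite big_nil; exact: bounded_measurable_cst.
under eq_fun do rewrite big_cons.
by case: (P i) => //; exact: bounded_measurableD.
Qed.

Lemma bounded_measurable_comp d' (T' : measurableType d') (h : T' -> T) f :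
  measurable_fun [set: T'] h -> bounded_measurable f ->
  bounded_measurable (fun x => f (h x)).
Proof.
move=> mh [mf [C fC]]; split; first exact: measurableT_comp.
by exists C => x; exact: fC.
Qed.

Variable mu : probability T R.

Lemma bounded_measurable_integrable f :
  bounded_measurable f -> mu.-integrable [set: T] (EFin \o f).
Proof.
move=> [mf [C fC]]; apply: measurable_bounded_integrable => //.
  by rewrite (le_lt_trans (probability_le1 mu measurableT))// ltry.
exists C; split; first by rewrite num_real.
by move=> x Cx y _; exact: le_trans (fC y) (ltW Cx).
Qed.

Lemma mean_EFin f : bounded_measurable f ->
  (\int[mu]_x (f x)%:E)%E = (\int[mu]_x f x)%:E.
Proof.
move=> /bounded_measurable_integrable mf.
by rewrite /Rintegral fineK//; exact: integrable_fin_num.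
Qed.

Lemma mean_cst (c : R) : \int[mu]_x c = c.
Proof. by rewrite Rintegral_cst//= probability_setT mulr1. Qed.

Lemma meanD f g : bounded_measurable f -> bounded_measurable g ->
  \int[mu]_x (f x + g x) = \int[mu]_x f x + \int[mu]_x g x.
Proof.
by move=> *; rewrite RintegralD//; exact: bounded_measurable_integrable.
Qed.

Lemma meanB f g : bounded_measurable f -> bounded_measurable g ->
  \int[mu]_x (f x - g x) = \int[mu]_x f x - \int[mu]_x g x.
Proof.
by move=> *; rewrite RintegralB//; exact: bounded_measurable_integrable.
Qed.

Lemma meanZ c f : bounded_measurable f ->
  \int[mu]_x (c * f x) = c * \int[mu]_x f x.
Proof.
by move=> *; rewrite RintegralZl//; exact: bounded_measurable_integrable.
Qed.

Lemma le_mean f g : bounded_measurable f -> bounded_measurable g ->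
  (forall x, f x <= g x) -> \int[mu]_x f x <= \int[mu]_x g x.
Proof.
by move=> *; apply: le_Rintegral => //; exact: bounded_measurable_integrable.
Qed.

Lemma mean_ge0 f : (forall x, 0 <= f x) -> 0 <= \int[mu]_x f x.
Proof. by move=> f0; apply: Rintegral_ge0. Qed.

Lemma mean_sum (I : Type) (s : seq I) (P : pred I) (F : I -> T -> R) :
  (forall i, bounded_measurable (F i)) ->
  \int[mu]_x (\sum_(i <- s | P i) F i x)
  = \sum_(i <- s | P i) \int[mu]_x F i x.
Proof.
move=> mF; elim: s => [|i s IHs].
  by under eq_Rintegral do rewrite big_nil; rewrite big_nil mean_cst.
under eq_Rintegral do rewrite big_cons.
rewrite big_cons; case: (P i) => //; rewrite meanD ?IHs//.
exact: bounded_measurable_sum.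
Qed.

Lemma eq_mean f g : f =1 g -> \int[mu]_x f x = \int[mu]_x g x.
Proof. by move=> fg; congr Rintegral; exact/funext. Qed.

Lemma mean_bound g C :
  bounded_measurable g -> (forall x, `|g x| <= C) -> `|\int[mu]_x g x| <= C.
Proof.
move=> bg gC; have bc (c : R) := bounded_measurable_cst c.
rewrite ler_norml -{1}(mean_cst (- C)) -{2}(mean_cst C) !le_mean// => x.
  by have := gC x; rewrite ler_norml => /andP[].
by have := gC x; rewrite ler_norml => /andP[].
Qed.

End bounded_measurable.

(** Change of variables, stated for a bare map so that it serves [resample] and [update]
    directly. *)
Lemma mean_law d (T : measurableType d) (R : realType)
    (mu : probability T R) d' (T' : measurableType d') (nu : probability T' R)
    (phi : T' -> T) (f : T -> R) : measurable_fun [set: T'] phi ->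
  (forall B, measurable B -> nu (phi @^-1` B) = mu B) ->
  bounded_measurable f -> \int[mu]_x f x = \int[nu]_y f (phi y).
Proof.
move=> mphi law bf; rewrite /Rintegral; congr fine.
have -> : (\int[mu]_x (f x)%:E = \int[pushforward nu phi]_x (f x)%:E)%E.
  by apply: eq_measure_integral => /= B mB _; rewrite -law.
rewrite (@integral_pushforward _ _ _ _ _ phi mphi nu setT (EFin \o f))//.
  exact/measurable_EFinP/bf.1.
rewrite preimage_setT.
exact: (bounded_measurable_integrable nu (bounded_measurable_comp mphi bf)).
Qed.

(** * Fubini's theorem for means *)

Section mean_product.
Context {d1 d2} {T1 : measurableType d1} {T2 : measurableType d2}
  {R : realType}.
Variables (P1 : probability T1 R) (P2 : probability T2 R).
Variable f : T1 * T2 -> R.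
Hypothesis bf : bounded_measurable f.

Lemma bounded_measurable_section1 x : bounded_measurable (fun y => f (x, y)).
Proof. by apply: bounded_measurable_comp bf; exact: pair1_measurable. Qed.

Lemma bounded_measurable_section2 y : bounded_measurable (fun x => f (x, y)).
Proof. by apply: bounded_measurable_comp bf; exact: pair2_measurable. Qed.

Let bmf : (P1 \x P2)%E.-integrable [set: T1 * T2] (EFin \o f).
Proof. exact: (bounded_measurable_integrable (P1 \x P2)%E bf). Qed.

Lemma bounded_measurable_mean1 :
  bounded_measurable (fun x => \int[P2]_y f (x, y)).
Proof.
split.
  apply/measurable_EFinP => /=.
  rewrite (_ : _ \o _ = fubini_F P2 (EFin \o f)); last first.
    apply/funext => x /=; rewrite -mean_EFin//.
    exact: bounded_measurable_section1.
  exact: measurable_fubini_F bmf.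
have [_ [C fC]] := bf; exists C => x; apply: mean_bound => //.
exact: bounded_measurable_section1.
Qed.

Lemma mean_product1 :
  \int[(P1 \x P2)%E]_xy f xy = \int[P1]_x \int[P2]_y f (x, y).
Proof.
rewrite /Rintegral -(integral12_prod_meas1 bmf); congr fine.
apply: eq_integral => x _; rewrite /fubini_F/= mean_EFin//.
exact: bounded_measurable_section1.
Qed.

Lemma mean_product2 :
  \int[(P1 \x P2)%E]_xy f xy = \int[P2]_y \int[P1]_x f (x, y).
Proof.
rewrite /Rintegral -(integral21_prod_meas1 bmf); congr fine.
apply: eq_integral => y _; rewrite /fubini_G/= mean_EFin//.
exact: bounded_measurable_section2.
Qed.

End mean_product.

(** * Resampling from a product law *)

Definition box (T : Type) n (B : 'I_n -> set T) : set (n.-tuple T) :=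
  [set s | forall i, B i (tnth s i)].

(** The [n]-fold power of [D], characterized by its values on boxes rather than constructed; the law
    of the sample is later shown to satisfy it. *)
Definition product_law d (T : measurableType d) (R : realType)
    (D : probability T R) n (Q : probability (n.-tuple T) R) : Prop :=
  forall B : 'I_n -> set T, (forall i, measurable (B i)) ->
    Q (box B) = (\prod_(i < n) D (B i))%E.

Section boxes.
Context {d} {T : measurableType d} {n : nat}.

Lemma measurable_box (B : 'I_n -> set T) : (forall i, measurable (B i)) ->
  measurable (box B).
Proof.
move=> mB; rewrite (_ : box B = \bigcap_(i in [set: 'I_n])
    ((@tnth n T ^~ i) @^-1` B i)); last first.
  by apply/seteqP; split=> s /= sB i; [move=> _; exact: sB|exact: sB].
apply: fin_bigcap_measurable => // i _.
by rewrite -[X in measurable X]setTI; exact: measurable_tnth.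
Qed.

Lemma measurable_tupleE :
  @measurable _ (n.-tuple T)
  = <<s [set box B | B in [set B | forall i, measurable (B i)]] >>.
Proof.
apply/seteqP; split; last first.
  apply: smallest_sub; first exact: sigma_algebra_measurable.
  by move=> _ [B mB <-]; exact: measurable_box.
apply: smallest_sub; first exact: smallest_sigma_algebra.
move=> A; rewrite -bigcup_seq => -[i _ [B mB <-]].
(* A one-coordinate cylinder is a box whose other sides are the whole space. *)
apply: sub_sigma_algebra; exists (fun j => if j == i then B else setT).
  by move=> j; case: ifP.
rewrite setTI; apply/seteqP; split=> s /=.
  by move=> /(_ i); rewrite eqxx.
by move=> Bi j; case: eqP => [->|].
Qed.

Lemma boxI (B C : 'I_n -> set T) :
  box B `&` box C = box (fun i => B i `&` C i).
Proof.
apply/seteqP; split=> s /=.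
  by move=> [sB sC] i; split; [exact: sB|exact: sC].
by move=> sBC; split=> i; have [] := sBC i.
Qed.

Context {R : realType}.

(** Boxes are stable under intersection and generate the sigma-algebra, so two probabilities that
    agree on them coincide. *)
Lemma product_law_unique (D : probability T R) (Q : probability (n.-tuple T) R)
    d' (W : measurableType d') (P : probability W R) (phi : W -> n.-tuple T) :
  product_law D Q -> measurable_fun [set: W] phi ->
  (forall B : 'I_n -> set T, (forall i, measurable (B i)) ->
     P (phi @^-1` box B) = (\prod_(i < n) D (B i))%E) ->
  forall A, measurable A -> P (phi @^-1` A) = Q A.
Proof.
move=> QD mphi PD A mA.
pose mphi' := isMeasurableFun.Build _ _ _ _ phi mphi.
pose phi' : {mfun W >-> n.-tuple T} := HB.pack phi mphi'.
pose G := [set box B |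
  B in [set B : 'I_n -> set T | forall i, measurable (B i)]].
have GT : G setT by exists (fun=> setT) => //; apply/seteqP.
rewrite -[LHS]/(distribution P phi' A).
apply: (measure_unique G (fun=> setT)) => //.
- exact: measurable_tupleE.
- move=> _ _ [B mB <-] [C mC <-]; exists (fun i => B i `&` C i).
    by move=> i; exact: measurableI.
  by rewrite boxI.
- by rewrite bigcup_const//; exists 0.
- by move=> _ [B mB <-]; rewrite /= /distribution /pushforward PD// QD.
- by move=> _; rewrite (le_lt_trans (probability_le1 _ measurableT))// ltry.
Qed.

End boxes.

Section resampling.
Context {d} {T : measurableType d} {n : nat} {R : realType}.
Variables (D : probability T R) (Q : probability (n.-tuple T) R).
Hypothesis QD : product_law D Q.

Definition resample (J : {set 'I_n}) (s s' : n.-tuple T) : n.-tuple T :=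
  [tuple if i \in J then tnth s' i else tnth s i | i < n].

Definition update (i : 'I_n) (s : n.-tuple T) (z : T) : n.-tuple T :=
  [tuple if j == i then z else tnth s j | j < n].

Lemma measurable_resample J :
  measurable_fun [set: n.-tuple T * n.-tuple T]
    (fun ss => resample J ss.1 ss.2).
Proof.
apply/measurable_fun_tnthP => i /=; rewrite /comp.
under eq_fun do rewrite tnth_mktuple.
by case: (i \in J); apply: (measurableT_comp (measurable_tnth i)).
Qed.

Lemma measurable_update i :
  measurable_fun [set: n.-tuple T * T] (fun sz => update i sz.1 sz.2).
Proof.
apply/measurable_fun_tnthP => j /=; rewrite /comp.
under eq_fun do rewrite tnth_mktuple.
case: (j == i); first exact: measurable_snd.
exact: (measurableT_comp (measurable_tnth j)).
Qed.

(** The preimage of a box is a product of two boxes: each coordinate constrains exactly one of the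
    two samples, the other side being the whole space. *)
Lemma law_resample J A : measurable A ->
  (Q \x Q)%E ((fun ss => resample J ss.1 ss.2) @^-1` A) = Q A.
Proof.
apply: (@product_law_unique _ _ _ _ _ _ _ _ (Q \x Q)%E _ QD).
  exact: measurable_resample.
move=> B mB.
pose B1 i := if i \in J then setT else B i.
pose B2 i := if i \in J then B i else setT.
have mB1 i : measurable (B1 i) by rewrite /B1; case: ifP.
have mB2 i : measurable (B2 i) by rewrite /B2; case: ifP.
rewrite (_ : _ @^-1` _ = box B1 `*` box B2); last first.
  apply/seteqP; split=> -[s s'] /=; rewrite /box /B1 /B2/=.
    by move=> sB; split=> i; have := sB i; rewrite tnth_mktuple; case: ifP.
  by move=> [sB sB'] i; have := sB i; have := sB' i;
     rewrite tnth_mktuple; case: ifP.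
transitivity (Q (box B1) * Q (box B2))%E.
  by apply: product_measure1E; exact: measurable_box.
rewrite !QD// -big_split/=; apply: eq_bigr => i _.
by rewrite /B1 /B2; case: ifP => _; rewrite probability_setT ?mul1e ?mule1.
Qed.

Lemma law_update i A : measurable A ->
  (Q \x D)%E ((fun sz => update i sz.1 sz.2) @^-1` A) = Q A.
Proof.
apply: (@product_law_unique _ _ _ _ _ _ _ _ (Q \x D)%E _ QD).
  exact: measurable_update.
move=> B mB.
pose B1 j := if j == i then setT else B j.
have mB1 j : measurable (B1 j) by rewrite /B1; case: ifP.
rewrite (_ : _ @^-1` _ = box B1 `*` B i); last first.
  apply/seteqP; split=> -[s s'] /=; rewrite /box /B1/=.
    move=> sB; split=> [j|]; last by have := sB i; rewrite tnth_mktuple eqxx.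
    by have := sB j; rewrite tnth_mktuple; case: ifP.
  by move=> [sB sB'] j; have := sB j; rewrite tnth_mktuple; case: eqP => [->|].
transitivity (Q (box B1) * D (B i))%E.
  by apply: product_measure1E => //; exact: measurable_box.
rewrite QD// (bigD1 i)//= [RHS](bigD1 i)//= {1}/B1 eqxx probability_setT mul1e.
rewrite muleC; congr (_ * _)%E; apply: eq_bigr => j ji.
by rewrite /B1 (negbTE ji).
Qed.

(** [U] is general so that [f] may return a function of the test point; this is how a predictor
    trained without the points of [J] is described. *)
Definition free_of (J : {set 'I_n}) (U : Type) (f : n.-tuple T -> U) : Prop :=
  forall s s', (forall i, i \notin J -> tnth s i = tnth s' i) -> f s = f s'.

Lemma mean_resample J f : bounded_measurable f ->
  \int[Q]_s f s = \int[Q]_s \int[Q]_s' f (resample J s s').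
Proof.
move=> bf; rewrite (mean_law (measurable_resample J) (law_resample J) bf).
rewrite mean_product1//.
exact: bounded_measurable_comp (measurable_resample J) bf.
Qed.

Lemma mean_update i f : bounded_measurable f ->
  \int[Q]_s f s = \int[Q]_s \int[D]_z f (update i s z).
Proof.
move=> bf; rewrite (mean_law (measurable_update i) (law_update i) bf).
rewrite mean_product1//.
exact: bounded_measurable_comp (measurable_update i) bf.
Qed.

End resampling.

(** * Decoupling two folds *)

Lemma free_ofS d (T : measurableType d) n (J L : {set 'I_n}) (U : Type)
  (f : n.-tuple T -> U) : L \subset J -> free_of J f -> free_of L f.
Proof.
move=> LJ fJ s s' ss'; apply: fJ => i iJ; apply: ss'.
by apply: contraNN iJ => /(fintype.subsetP LJ).
Qed.

(** Follows the syntax of the integrand down to constants and to functions known from the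
    context. *)
Ltac bounded_measurable_tac :=
  repeat first [ assumption
  | match goal with
    | |- bounded_measurable (fun x => @?f x - @?g x) =>
        apply: (@bounded_measurableB _ _ _ f g)
    | |- bounded_measurable (fun x => @?f x + @?g x) =>
        apply: (@bounded_measurableD _ _ _ f g)
    | |- bounded_measurable (fun x => @?f x * @?g x) =>
        apply: (@bounded_measurableM _ _ _ f g)
    | |- bounded_measurable (fun x => @?f x ^+ ?n) =>
        apply: (@bounded_measurableX _ _ _ f n)
    | |- bounded_measurable (fun x => `|@?f x|) =>
        apply: (@bounded_measurable_norm _ _ _ f)
    | |- bounded_measurable (fun x => ?c) =>
        apply: bounded_measurable_cst
    end ].

Section decoupling.
Context {d} {T : measurableType d} {n : nat} {R : realType}.
Variables (D : probability T R) (Q : probability (n.-tuple T) R).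
Hypothesis QD : product_law D Q.
Implicit Types (h a b : n.-tuple T * T -> R) (J L : {set 'I_n}).

Local Notation free J h := (free_of J (fun s z => h (s, z))).
Local Notation "''E' h" := (Rintegral (Q \x D)%E setT h)
  (at level 10, h at level 8).

Lemma freeP J h s s' z : free J h ->
  (forall i, i \notin J -> tnth s i = tnth s' i) -> h (s, z) = h (s', z).
Proof. by move=> hJ ss'; have /(congr1 (@^~ z)) := hJ _ _ ss'. Qed.

Lemma bounded_measurable_at i h : bounded_measurable h ->
  bounded_measurable (fun s => h (s, tnth s i)).
Proof.
apply: bounded_measurable_comp; apply: measurable_fun_pair => //.
exact: measurable_tnth.
Qed.

(* A point that was left out of training plays the role of a fresh one. *)
Lemma mean_at i h : bounded_measurable h -> free [set i] h ->
  \int[Q]_s h (s, tnth s i) = 'E h.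
Proof.
move=> bh hi; rewrite (mean_product1 Q D bh).
rewrite (mean_update QD i (bounded_measurable_at i bh)).
apply: eq_mean => s; apply: eq_mean => z; rewrite tnth_mktuple eqxx.
apply: (freeP _ hi) => j; rewrite inE => ji.
by rewrite tnth_mktuple (negbTE ji).
Qed.

(** Given the coordinates other than [i], the factor [c] is constant and the point at [i] is a fresh
    one, over which [h] has mean zero. *)
Lemma mean_at_centered i h (c : n.-tuple T -> R) :
  bounded_measurable h -> bounded_measurable c ->
  free [set i] h -> free_of [set i] c ->
  (forall s, \int[D]_z h (s, z) = 0) ->
  \int[Q]_s (h (s, tnth s i) * c s) = 0.
Proof.
move=> bh bc hi ci h0.
have bc' : bounded_measurable (fun sz : n.-tuple T * T => c sz.1).
  exact: bounded_measurable_comp bc.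
have bhc := bounded_measurableM bh bc'.
rewrite (mean_at (i := i) bhc); last first.
  move=> s s' ss'; apply/funext => z /=.
  by rewrite (freeP z hi ss') (ci _ _ ss').
rewrite (mean_product1 Q D bhc) -[RHS](mean_cst Q); apply: eq_mean => s /=.
under eq_Rintegral do rewrite mulrC.
by rewrite meanZ ?h0 ?mulr0//; exact: bounded_measurable_section1.
Qed.

(** The conditional expectation of [h] given the test point and the coordinates outside [L],
    realized pointwise by integrating over an independent copy of the sample. *)
Definition average L h (sz : n.-tuple T * T) : R :=
  \int[Q]_s' h (resample L sz.1 s', sz.2).

Lemma bounded_measurable_resample L h : bounded_measurable h ->
  bounded_measurable (fun w : (n.-tuple T * T) * n.-tuple T =>
    h (resample L w.1.1 w.2, w.1.2)).
Proof.
apply: bounded_measurable_comp; apply: measurable_fun_pair; last first.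
  exact: measurableT_comp.
have mp : measurable_fun setT
    (fun w : (n.-tuple T * T) * n.-tuple T => (w.1.1, w.2)).
  by apply: measurable_fun_pair => //; exact: measurableT_comp.
exact: (measurableT_comp (measurable_resample L) mp).
Qed.

Lemma bounded_measurable_average L h : bounded_measurable h ->
  bounded_measurable (average L h).
Proof.
move=> /(bounded_measurable_resample L) bh.
exact: (bounded_measurable_mean1 (Q \x D)%E Q bh).
Qed.

Lemma average_free L h : free L (average L h).
Proof.
move=> s s' ss'; apply/funext => z; apply: eq_mean => s'' /=.
congr (h (_, z)); apply: eq_from_tnth => i; rewrite !tnth_mktuple.
by case: ifPn => // /ss'.
Qed.

Lemma average_free_other J L h : free J h -> free J (average L h).
Proof.
move=> hJ s s' ss'; apply/funext => z; apply: eq_mean => s'' /=.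
apply: (freeP _ hJ) => i iJ; rewrite !tnth_mktuple.
by case: ifPn => // _; exact: ss'.
Qed.

(** By Fubini the test point can be integrated first, inside the mean over the resampled points. *)
Lemma average_centered L h : bounded_measurable h ->
  (forall s, \int[D]_z h (s, z) = 0) ->
  forall s, \int[D]_z average L h (s, z) = 0.
Proof.
move=> bh h0 s; rewrite /average/=.
have bh' : bounded_measurable
    (fun sz : n.-tuple T * T => h (resample L s sz.1, sz.2)).
  apply: (bounded_measurable_comp (h := fun sz => ((s, sz.2), sz.1))
    _ (bounded_measurable_resample L bh)).
  by do 2 apply: measurable_fun_pair => //.
rewrite -(mean_product2 Q D bh') (mean_product1 Q D bh') -[RHS](mean_cst Q).
by apply: eq_mean => s' /=.
Qed.

(** The defining property of a conditional expectation: resampling [L] acts on [h] and leaves [c]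
    fixed. *)
Lemma mean_average L h c : bounded_measurable h -> bounded_measurable c ->
  free L c -> 'E (fun w => h w * c w) = 'E (fun w => average L h w * c w).
Proof.
move=> bh bc cL.
have bhc := bounded_measurableM bh bc.
have bac := bounded_measurableM (bounded_measurable_average L bh) bc.
rewrite (mean_product2 Q D bhc) (mean_product2 Q D bac); apply: eq_mean => z.
rewrite (mean_resample QD L (bounded_measurable_section2 bhc z)).
apply: eq_mean => s; rewrite mulrC -meanZ; last first.
  apply: (bounded_measurable_comp (h := fun s' => ((s, z), s'))
    _ (bounded_measurable_resample L bh)).
  exact: pair1_measurable.
apply: eq_mean => s'; rewrite mulrC; congr (_ * _).
by apply: (freeP _ cL) => i iL; rewrite tnth_mktuple (negbTE iL).
Qed.

(* Let [a'] be [a] with its dependence on [L] averaged out, and [b'] be [b] with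
   its dependence on [J] averaged out.  In the expectation of the square of
   [(a - a') - (b - b')], with [a, a'] read at [i] and [b, b'] at [j], every
   cross term except [a * b] vanishes by centering, whereas the mean of
   [a * b] over a common fresh point equals that of [a' * b']. *)
Lemma mean_cross_le J L i j a b :
  (forall t, t \in J -> t \notin L) -> i \in J -> j \in L ->
  bounded_measurable a -> bounded_measurable b -> free J a -> free L b ->
  (forall s, \int[D]_z a (s, z) = 0) -> (forall s, \int[D]_z b (s, z) = 0) ->
  2 * \int[Q]_s (a (s, tnth s i) * b (s, tnth s j))
  <= 'E (fun w => (a w - b w) ^+ 2).
Proof.
move=> JL iJ jL ba bb aJ bL a0 b0.
pose a' := average L a; pose b' := average J b.
have ba' : bounded_measurable a' by exact: bounded_measurable_average.
have bb' : bounded_measurable b' by exact: bounded_measurable_average.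
have iJs : [set i]%SET \subset J by rewrite finset.sub1set.
have jLs : [set j]%SET \subset L by rewrite finset.sub1set.
have ai := free_ofS iJs aJ.
have bj := free_ofS jLs bL.
have a'i : free [set i] a' by exact: free_ofS iJs (average_free_other L aJ).
have b'j : free [set j] b' by exact: free_ofS jLs (average_free_other J bL).
have a'j : free [set j] a' by exact: free_ofS jLs (average_free a).
have b'i : free [set i] b' by exact: free_ofS iJs (average_free b).
have a'0 := average_centered L ba a0.
have b'0 := average_centered J bb b0.
have ij : i != j.
  by apply: contraTneq jL => <-; exact: JL.
have frz (h : n.-tuple T * T -> R) (k l : 'I_n) : l != k -> free [set k] h ->
    free_of [set k] (fun s => h (s, tnth s l)).
  move=> lk hk s s' ss'; rewrite (ss' l) ?inE//; exact: freeP hk ss'.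
pose A s := a (s, tnth s i); pose A' s := a' (s, tnth s i).
pose B s := b (s, tnth s j); pose B' s := b' (s, tnth s j).
have bA : bounded_measurable A by exact: bounded_measurable_at.
have bA' : bounded_measurable A' by exact: bounded_measurable_at.
have bB : bounded_measurable B by exact: bounded_measurable_at.
have bB' : bounded_measurable B' by exact: bounded_measurable_at.
have AB' : \int[Q]_s (A s * B' s) = 0.
  by apply: mean_at_centered => //; apply: frz => //; rewrite eq_sym.
have A'B' : \int[Q]_s (A' s * B' s) = 0.
  by apply: mean_at_centered => //; apply: frz => //; rewrite eq_sym.
have A'B : \int[Q]_s (A' s * B s) = 0.
  under eq_Rintegral do rewrite mulrC.
  by apply: mean_at_centered => //; apply: frz.
(* Pythagoras: the last hypothesis makes [h - h'] orthogonal to [h'], and both functions ignore the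
   point at [k], which thus counts as fresh. *)
have sqB (k : 'I_n) h h' : bounded_measurable h -> bounded_measurable h' ->
    free [set k] h -> free [set k] h' ->
    'E (fun w => h w * h' w) = 'E (fun w => h' w * h' w) ->
    \int[Q]_s (h (s, tnth s k) - h' (s, tnth s k)) ^+ 2
    = 'E (fun w => h w ^+ 2) - 'E (fun w => h' w ^+ 2).
  move=> bh bh' hk h'k hh'.
  rewrite (mean_at (i := k) (h := fun w => (h w - h' w) ^+ 2)).
  - transitivity ('E (fun w => h w ^+ 2 - 2 * (h w * h' w) + h' w ^+ 2)).
      by apply: eq_mean => w; ring.
    rewrite meanD ?meanB ?meanZ ?hh'; try by bounded_measurable_tac.
    by rewrite (_ : (fun w => h' w * h' w) = (fun w => h' w ^+ 2)) //; lra.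
  - by bounded_measurable_tac.
  - move=> s s' ss'; apply/funext => z.
    by rewrite (freeP z hk ss') (freeP z h'k ss').
have mA : \int[Q]_s (A s - A' s) ^+ 2
    = 'E (fun w => a w ^+ 2) - 'E (fun w => a' w ^+ 2).
  by apply: sqB => //; apply: mean_average => //; exact: average_free.
have mB : \int[Q]_s (B s - B' s) ^+ 2
    = 'E (fun w => b w ^+ 2) - 'E (fun w => b' w ^+ 2).
  by apply: sqB => //; apply: mean_average => //; exact: average_free.
(* Average over [L] first, since [b] ignores it, then over [J], since [a'] ignores it. *)
have ab : 'E (fun w => a w * b w) = 'E (fun w => a' w * b' w).
  rewrite (mean_average ba bb bL).
  under eq_Rintegral do rewrite mulrC.
  rewrite (mean_average bb ba' (average_free_other L aJ)).
  by under eq_Rintegral do rewrite mulrC.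
have -> : 2 * \int[Q]_s (A s * B s) = \int[Q]_s ((A s - A' s) ^+ 2)
    + \int[Q]_s ((B s - B' s) ^+ 2)
    - \int[Q]_s (((A s - A' s) - (B s - B' s)) ^+ 2).
  (* The three inserted terms have mean zero and complete [A * B] to [(A - A') * (B - B')], which is
     then polarized. *)
  transitivity (\int[Q]_s (2 * (A s * B s) - 2 * (A s * B' s)
      - 2 * (A' s * B s) + 2 * (A' s * B' s))).
    rewrite meanD ?meanB ?meanZ; try by bounded_measurable_tac.
    by rewrite AB' A'B A'B' !mulr0 !subr0 addr0.
  rewrite -meanD -?meanB; try by bounded_measurable_tac.
  by apply: eq_mean => s; ring.
have -> : 'E (fun w => (a w - b w) ^+ 2) = 'E (fun w => a w ^+ 2)
    + 'E (fun w => b w ^+ 2) - 2 * 'E (fun w => a w * b w).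
  rewrite -meanZ -?meanD -?meanB; try by bounded_measurable_tac.
  by apply: eq_mean => w; ring.
have a'b' : 0 <= 'E (fun w => a' w ^+ 2)
    + 'E (fun w => b' w ^+ 2) - 2 * 'E (fun w => a' w * b' w).
  rewrite -meanZ -?meanD -?meanB; try by bounded_measurable_tac.
  apply: mean_ge0 => w.
  by rewrite (_ : _ - _ = (a' w - b' w) ^+ 2) ?sqr_ge0//; ring.
have sq_ge0 := mean_ge0 Q (fun s => sqr_ge0 ((A s - A' s) - (B s - B' s))).
(* Here [x], [y], [x'], [y'] stand for the mean squares of [a], [b], [a'], [b'], while [z] is the
   mean of [a' * b'] and [c] that of the discarded square. *)
have arith (x y x' y' z c : R) : 0 <= c -> 0 <= x' + y' - 2 * z ->
  x - x' + (y - y') - c <= x + y - 2 * z by clear -R; lra.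
by rewrite mA mB ab; exact: arith.
Qed.

End decoupling.

(** * Second moment of the cross-validation gap *)

Lemma mean_variance d (T : measurableType d) (R : realType)
    (mu : probability T R) (f : T -> R) : bounded_measurable f ->
  \int[mu]_x (f x - \int[mu]_y f y) ^+ 2
  = \int[mu]_x (f x ^+ 2) - (\int[mu]_x f x) ^+ 2.
Proof.
move=> bf; set m := \int[mu]_y f y.
transitivity (\int[mu]_x (f x ^+ 2 - 2 * m * f x + m ^+ 2)).
  by apply: eq_mean => x; ring.
rewrite meanD ?meanB ?meanZ ?mean_cst -/m; try by bounded_measurable_tac.
ring.
Qed.

(** Jensen's inequality for the square, from the nonnegativity of the sum of squared deviations from
    the average. *)
Lemma sqr_average_le (R : realFieldType) n (x : 'I_n -> R) :
  (0 < n)%N ->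
  (n%:R^-1 * \sum_(i < n) x i) ^+ 2 <= n%:R^-1 * \sum_(i < n) x i ^+ 2.
Proof.
move=> n0; set m := n%:R^-1 * _.
have nE : n%:R * m = \sum_(i < n) x i by rewrite mulVKf ?pnatr_eq0 -?lt0n.
have : 0 <= \sum_(i < n) (x i - m) ^+ 2.
  by apply: sumr_ge0 => i _; exact: sqr_ge0.
have -> : \sum_(i < n) (x i - m) ^+ 2
    = \sum_(i < n) x i ^+ 2 - 2 * m * (\sum_(i < n) x i) + n%:R * m ^+ 2.
  have -> : n%:R * m ^+ 2 = \sum_(i < n) m ^+ 2.
    by rewrite sumr_const card_ord mulr_natl.
  rewrite mulr_sumr -sumrB -big_split/=.
  by apply: eq_bigr => i _; ring.
rewrite -nE => H.
rewrite -(@ler_pM2l _ n%:R) ?ltr0n// mulVKf ?pnatr_eq0 -?lt0n//.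
lra.
Qed.

Section cross_validation.
Context {d} {T : measurableType d} {n k m : nat} {R : realType}.
Variables (D : probability T R) (Q : probability (n.-tuple T) R).
Hypothesis QD : product_law D Q.
Local Notation "''E' h" := (Rintegral (Q \x D)%E setT h)
  (at level 10, h at level 8).

(** An abstract form of the problem: [g] is the loss of the full predictor and [f j] that of the
    predictor trained without fold [j], both as functions of the sample and a test point. *)
Variables (fold : 'I_n -> 'I_k) (f : 'I_k -> n.-tuple T * T -> R)
  (g : n.-tuple T * T -> R) (M : R).
Hypothesis n0 : (0 < n)%N.
Hypothesis card_fold : forall j, #|[set i | fold i == j]%SET| = m.
Hypothesis f_free : forall j,
  free_of [set i | fold i == j] (fun s z => f j (s, z)).
Hypothesis bf : forall j, bounded_measurable (f j).
Hypothesis bg : bounded_measurable g.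
Hypothesis f0M : forall j w, 0 <= f j w <= M.
Hypothesis g0M : forall w, 0 <= g w <= M.

(** The risks [r] and [rf j] are conditional on the sample; [a (fold i)] read at the point [i] is
    the centered loss of that point. *)
Let r s := \int[D]_z g (s, z).
Let rf j s := \int[D]_z f j (s, z).
Let a j w := f j w - rf j w.1.

Let br : bounded_measurable r.
Proof. exact: (bounded_measurable_mean1 Q D bg). Qed.

Let brf j : bounded_measurable (rf j).
Proof. exact: (bounded_measurable_mean1 Q D (bf j)). Qed.

Let bfst (h : n.-tuple T -> R) : bounded_measurable h ->
  bounded_measurable (fun w : n.-tuple T * T => h w.1).
Proof. exact: bounded_measurable_comp. Qed.

Let ba j : bounded_measurable (a j).
Proof. by apply: bounded_measurableB => //; exact: bfst. Qed.

Let a_free j : free_of [set i | fold i == j] (fun s z => a j (s, z)).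
Proof.
move=> s s' ss'; have fE := f_free ss'.
apply/funext => z; rewrite /a /rf/=; congr (_ - _).
  exact: (congr1 (@^~ z) fE).
by apply: eq_mean => z'; exact: (congr1 (@^~ z') fE).
Qed.

Let a_centered j s : \int[D]_z a j (s, z) = 0.
Proof.
rewrite /a/= meanB ?mean_cst ?subrr//.
  exact: bounded_measurable_section1.
exact: bounded_measurable_cst.
Qed.

Let sum_fold (F : 'I_k -> R) :
  \sum_(i < n) F (fold i) = m%:R * \sum_(j < k) F j.
Proof.
rewrite (partition_big fold predT)//= mulr_sumr; apply: eq_bigr => j _.
rewrite (eq_bigr (fun=> F j)); last by move=> i /eqP ->.
rewrite sumr_const mulr_natl -(card_fold j); congr (_ *+ _).
by apply: eq_card => i; rewrite !inE.
Qed.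

Let nkm : n = (k * m)%N.
Proof.
have := sum_fold (fun=> 1); rewrite !sumr_const !card_ord -natrM => /eqP.
by rewrite eqr_nat mulnC => /eqP.
Qed.

(** The left side has the shape of the bound in [a_cross]. There are [n * m] ordered pairs sharing a
    fold, and each fold occurs [n * m] times in either position. *)
Let sum_fold_pairs (F : 'I_k -> R) (K : R) :
  \sum_(i < n) \sum_(i' < n)
    ((fold i' == fold i)%:R * K + (F (fold i) + F (fold i')))
  = n%:R * m%:R * (K + 2 * \sum_(j < k) F j).
Proof.
set c := \sum_(j < k) F j.
transitivity (\sum_(i < n) (m%:R * K + (n%:R * F (fold i) + m%:R * c))).
  apply: eq_bigr => i _; rewrite 2!big_split/= -mulr_suml (sum_fold F).
  rewrite sumr_const card_ord -[F _ *+ n]mulr_natl; congr (_ * _ + _).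
  rewrite -natr_sum -(card_fold (fold i)) -sum1_card [in RHS]big_mkcond/=.
  by congr (_%:R); apply: eq_bigr => i' _; rewrite inE; case: eqP.
have Fc : \sum_(i < n) (n%:R * F (fold i)) = n%:R * (m%:R * c).
  by rewrite -mulr_sumr (sum_fold F).
rewrite 2!big_split/= Fc !sumr_const !card_ord.
rewrite -[_ *+ n]mulr_natl -[(_ * c) *+ n]mulr_natl -/c; ring.
Qed.

Let V1 j := \int[Q]_s (r s - rf j s) ^+ 2.
Let V2 j := 'E (fun w => (g w - f j w - (r w.1 - rf j w.1)) ^+ 2).
Let stab j := 'E (fun w => `|f j w - g w|).

(** For a fixed sample, squared mean plus variance of [g - f j] over the test point is its second
    moment. Both losses lie in [[0, M]], so the square is at most [M] times the absolute value. *)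
Let V1V2 j : V1 j + V2 j <= M * stab j.
Proof.
have bG : bounded_measurable (fun w => g w - f j w) by bounded_measurable_tac.
have brw := bfst br; have brfw := bfst (brf j).
have -> : V1 j + V2 j = 'E (fun w => (g w - f j w) ^+ 2).
  rewrite /V2 mean_product1; last by bounded_measurable_tac.
  rewrite /V1 mean_product1; last by bounded_measurable_tac.
  rewrite -meanD; last 2 first.
  - by bounded_measurable_tac.
  - have bb : bounded_measurable
      (fun w => (g w - f j w - (r w.1 - rf j w.1)) ^+ 2).
      by bounded_measurable_tac.
    exact: (bounded_measurable_mean1 Q D bb).
  apply: eq_mean => s /=.
  have -> : r s - rf j s = \int[D]_z (g (s, z) - f j (s, z)).
    by rewrite meanB//; exact: bounded_measurable_section1.
  have /= -> := mean_variance D (bounded_measurable_section1 bG s).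
  by rewrite addrC subrK.
rewrite -meanZ; last by bounded_measurable_tac.
apply: le_mean => [||w]; try by bounded_measurable_tac.
rewrite distrC -[leLHS]real_normK ?num_real// expr2 ler_wpM2r// ler_norml.
have := f0M j w; have := g0M w; lra.
Qed.

(** Popoviciu's bound: a variable with values in [[0, M]] and mean [t] has variance at most
    [M * t - t ^ 2], hence at most [M ^ 2 / 4]. *)
Let a_sqr i : \int[Q]_s a (fold i) (s, tnth s i) ^+ 2 <= M ^+ 2 / 4.
Proof.
have ba2 := bounded_measurableX 2 (ba (fold i)).
rewrite (mean_at QD (i := i) ba2); last first.
  have fi : free_of [set i] (fun s z => a (fold i) (s, z)).
    by apply: free_ofS (@a_free (fold i)); rewrite finset.sub1set inE.
  move=> s s' ss'; apply/funext => z.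
  by rewrite (freeP z fi ss').
rewrite mean_product1// -[leRHS](mean_cst Q); apply: le_mean.
- exact: (bounded_measurable_mean1 Q D ba2).
- exact: bounded_measurable_cst.
- move=> s /=; have bfs := bounded_measurable_section1 (bf (fold i)) s.
  rewrite mean_variance//.
  have : \int[D]_z (f (fold i) (s, z) ^+ 2) <= M * rf (fold i) s.
    rewrite -meanZ//; apply: le_mean => [||z]; try by bounded_measurable_tac.
    by have := f0M (fold i) (s, z) => /andP[? ?]; rewrite expr2 ler_wpM2r.
  rewrite -/(rf (fold i) s); have := sqr_ge0 (rf (fold i) s - M / 2); nra.
Qed.

(** Within a fold, the product is at most the average of the two squares, which [a_sqr] bounds.
    Across folds, [mean_cross_le] applies with the two folds as [J] and [L]. *)
Let a_cross i i' :
  \int[Q]_s (a (fold i) (s, tnth s i) * a (fold i') (s, tnth s i'))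
  <= (fold i' == fold i)%:R * (M ^+ 2 / 4) + (V2 (fold i) + V2 (fold i')).
Proof.
have V2_ge0 j : 0 <= V2 j by apply: mean_ge0 => w; exact: sqr_ge0.
have bai := bounded_measurable_at i (ba (fold i)).
have bai' := bounded_measurable_at i' (ba (fold i')).
case: eqP => [ii'|/eqP ii'].
  rewrite mul1r.
  apply: (@le_trans _ _ (\int[Q]_s (2^-1 * (a (fold i) (s, tnth s i) ^+ 2 +
                                    a (fold i') (s, tnth s i') ^+ 2)))).
    apply: le_mean => [||s]; try by bounded_measurable_tac.
    have := sqr_ge0 (a (fold i) (s, tnth s i) - a (fold i') (s, tnth s i')).
    nra.
  rewrite meanZ ?meanD; try by bounded_measurable_tac.
  apply: (@le_trans _ _ (2^-1 * (M ^+ 2 / 4 + M ^+ 2 / 4))).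
    by rewrite ler_wpM2l// ?invr_ge0//; exact: lerD.
  by rewrite [leLHS](_ : _ = M ^+ 2 / 4) ?lerDl ?addr_ge0//; field.
rewrite mul0r add0r.
have := mean_cross_le QD (J := [set t | fold t == fold i]%SET)
  (L := [set t | fold t == fold i']%SET) (i := i) (j := i') _ _ _
  (ba (fold i)) (ba (fold i')) (@a_free _) (@a_free _)
  (a_centered _) (a_centered _).
rewrite !inE !eqxx => /(_ _ isT isT) H.
rewrite -(@ler_pM2l _ 2)//; apply: (le_trans (H _)).
  by move=> t; rewrite !inE => /eqP ->; rewrite eq_sym.
have : 'E (fun w => (a (fold i) w - a (fold i') w) ^+ 2) <=
   2 * (V2 (fold i) + V2 (fold i')).
  have b1 := bfst (brf (fold i)); have b2 := bfst (brf (fold i')).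
  have b3 := bfst br.
  have b4 := bf (fold i); have b5 := bf (fold i').
  have b6 := ba (fold i); have b7 := ba (fold i').
  rewrite -meanD -?meanZ; try by bounded_measurable_tac.
  apply: le_mean => [||w]; try by bounded_measurable_tac.
  (* The centered loss of the full predictor is the intermediate point, and [(y - x) ^ 2] is at most
     [2 * (x ^ 2 + y ^ 2)]. *)
  rewrite /a; set x := g w - f (fold i) w - _; set y := g w - f (fold i') w - _.
  have -> : f (fold i) w - rf (fold i) w.1 - (f (fold i') w - rf (fold i') w.1)
    = y - x by rewrite /x /y; ring.
  have := sqr_ge0 (x + y); nra.
by [].
Qed.

Lemma cross_validation_second_moment :
  \int[Q]_s (r s - n%:R^-1 * \sum_(i < n) f (fold i) (s, tnth s i)) ^+ 2
  <= 3 * M * (k%:R^-1 * \sum_(j < k) stab j) + 3 / 8 * M ^+ 2 / k%:R.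
Proof.
have bat i := bounded_measurable_at i (ba (fold i)).
have bft i := bounded_measurable_at i (bf (fold i)).
have b1 i : bounded_measurable (fun s => r s - rf (fold i) s).
  exact: bounded_measurableB.
have b2 i : bounded_measurable (fun s => (r s - rf (fold i) s) ^+ 2).
  exact: bounded_measurableX.
have b3 i i' : bounded_measurable
    (fun s => a (fold i) (s, tnth s i) * a (fold i') (s, tnth s i')).
  exact: bounded_measurableM.
have b4 : bounded_measurable (fun s => \sum_(i < n) (r s - rf (fold i) s) ^+ 2).
  exact: bounded_measurable_sum.
have b4' i : bounded_measurable (fun s => \sum_(i' < n)
    a (fold i) (s, tnth s i) * a (fold i') (s, tnth s i')).
  exact: bounded_measurable_sum.
have b5 : bounded_measurable (fun s => \sum_(i < n) \sum_(i' < n)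
    a (fold i) (s, tnth s i) * a (fold i') (s, tnth s i')).
  exact: bounded_measurable_sum.
have b6 : bounded_measurable (fun s => \sum_(i < n) f (fold i) (s, tnth s i)).
  exact: bounded_measurable_sum.
have nn0 : n%:R != 0 :> R by rewrite pnatr_eq0 -lt0n.
(* [(u - v)^2 <= 3 u^2 + 3/2 v^2]: the weights make the contributions of [V1]
   and [V2] equal, so that they add up to a second moment. *)
apply: (@le_trans _ _ (\int[Q]_s
    (3 * n%:R^-1 * (\sum_(i < n) (r s - rf (fold i) s) ^+ 2)
     + 3 / 2 * n%:R^-2 * (\sum_(i < n) \sum_(i' < n)
        a (fold i) (s, tnth s i) * a (fold i') (s, tnth s i'))))).
  apply: le_mean => [||s]; try by bounded_measurable_tac.
  set u := n%:R^-1 * \sum_(i < n) (r s - rf (fold i) s).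
  set v := n%:R^-1 * \sum_(i < n) a (fold i) (s, tnth s i).
  (* Adding and subtracting [rf (fold i) s] splits the gap into the mean risk difference [u] and the
     mean centered loss [v]. *)
  have -> : r s - n%:R^-1 * (\sum_(i < n) f (fold i) (s, tnth s i)) = u - v.
    rewrite /u /v -mulrBr -sumrB.
    rewrite [in RHS](eq_bigr (fun i => r s - f (fold i) (s, tnth s i)));
      last first.
      by move=> i _; rewrite /a/= opprB addrA subrK.
    by rewrite sumrB sumr_const card_ord mulrBr -[r s *+ n]mulr_natl mulKf.
  have -> : \sum_(i < n) \sum_(i' < n)
        a (fold i) (s, tnth s i) * a (fold i') (s, tnth s i')
      = (\sum_(i < n) a (fold i) (s, tnth s i)) ^+ 2.
    by rewrite expr2 mulr_suml; apply: eq_bigr => i _; rewrite mulr_sumr.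
  have : u ^+ 2 <= n%:R^-1 * \sum_(i < n) (r s - rf (fold i) s) ^+ 2.
    exact: sqr_average_le.
  have : v ^+ 2 = n%:R^-2 * (\sum_(i < n) a (fold i) (s, tnth s i)) ^+ 2.
    by rewrite /v exprMn exprVn.
  (* The two sides of the weighted inequality differ by half of this square. *)
  have := sqr_ge0 (2 * u + v); nra.
rewrite meanD ?meanZ ?mean_sum; try by bounded_measurable_tac.
rewrite (sum_fold V1).
have -> : \sum_(i < n) \int[Q]_s (\sum_(i' < n)
      a (fold i) (s, tnth s i) * a (fold i') (s, tnth s i'))
    = \sum_(i < n) \sum_(i' < n) \int[Q]_s
      (a (fold i) (s, tnth s i) * a (fold i') (s, tnth s i')).
  by apply: eq_bigr => i _; rewrite mean_sum.
set S := \sum_(i < n) _.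
have Sle : S <= n%:R * m%:R * (M ^+ 2 / 4 + 2 * \sum_(j < k) V2 j).
  apply: (@le_trans _ _ (\sum_(i < n) \sum_(i' < n)
      ((fold i' == fold i)%:R * (M ^+ 2 / 4) + (V2 (fold i) + V2 (fold i'))))).
    by apply: ler_sum => i _; apply: ler_sum => i' _.
  by rewrite sum_fold_pairs.
have k0 : (0 < k)%N by move: n0; rewrite nkm muln_gt0 => /andP[].
have m0 : (0 < m)%N by move: n0; rewrite nkm muln_gt0 => /andP[].
have mR0 : m%:R != 0 :> R by rewrite pnatr_eq0 -lt0n.
have kR0 : k%:R != 0 :> R by rewrite pnatr_eq0 -lt0n.
have nE : n%:R = k%:R * m%:R :> R by rewrite -natrM -nkm.
have -> : 3 * n%:R^-1 * (m%:R * \sum_(j < k) V1 j)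
    = 3 * k%:R^-1 * \sum_(j < k) V1 j.
  by rewrite nE; field; rewrite mR0 kR0.
apply: (@le_trans _ _ (3 * k%:R^-1 * (\sum_(j < k) V1 j) + 3 / 2 * n%:R^-2 *
    (n%:R * m%:R * (M ^+ 2 / 4 + 2 * \sum_(j < k) V2 j)))).
  by rewrite lerD2l ler_wpM2l// mulr_ge0// ?divr_ge0// invr_ge0 exprn_ge0.
(* As [n = k * m], the pair count [n * m] divided by [n ^ 2] is [1 / k]. *)
have -> : 3 / 2 * n%:R^-2 * (n%:R * m%:R * (M ^+ 2 / 4 + 2 * \sum_(j < k) V2 j))
    = 3 / 8 * M ^+ 2 / k%:R + 3 * k%:R^-1 * \sum_(j < k) V2 j.
  by rewrite nE; field; rewrite mR0 kR0.
rewrite addrCA addrC lerD2r -mulrDr -big_split/=.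
have -> : 3 * M * (k%:R^-1 * \sum_(j < k) stab j)
    = 3 * k%:R^-1 * \sum_(j < k) (M * stab j) by rewrite -mulr_sumr; ring.
rewrite ler_wpM2l ?mulr_ge0 ?invr_ge0//.
by apply: ler_sum => j _.
Qed.

End cross_validation.

(** * Random partitions *)

Section random_index.
Context {dO dW : measure_display} {Omega : measurableType dO}
  {W : measurableType dW} {R : realType}.
Variables (P : probability Omega R) (Q : probability W R) (S : Omega -> W).
Hypothesis mS : measurable_fun [set: Omega] S.

Lemma bounded_measurable_indic (U : set Omega) : measurable U ->
  bounded_measurable (\1_U : Omega -> R).
Proof.
move=> mU; split; first exact: measurable_indic.
by exists 1 => w; rewrite indicE; case: (_ \in _); rewrite ?normr1 ?normr0.
Qed.

Lemma mean_indic (U : set Omega) : measurable U ->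
  \int[P]_w (\1_U w : R) = fine (P U).
Proof. by move=> mU; rewrite /Rintegral integral_indic// setIT. Qed.

(** Independence says that [P] restricted to [U] and pushed forward by [S] is the measure [Q] scaled
    by [P U]. *)
Lemma mean_indep (U : set Omega) (G : W -> R) : measurable U ->
  (forall E, measurable E -> P (U `&` (S @^-1` E)) = (P U * Q E)%E) ->
  bounded_measurable G -> (forall x, 0 <= G x) ->
  \int[P]_w (\1_U w * G (S w)) = fine (P U) * \int[Q]_x G x.
Proof.
move=> mU US bG G0.
have mGE : measurable_fun [set: W] (EFin \o G) by exact/measurable_EFinP/bG.1.
have mGS : measurable_fun [set: Omega] (EFin \o G \o S).
  exact: measurableT_comp.
have PU : P U \is a fin_num by exact: fin_num_measure.
have p0 : 0 <= fine (P U) by exact: fine_ge0.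
pose p : {nonneg R} := NngNum p0.
have bGS := bounded_measurable_comp mS bG.
have bI := bounded_measurable_indic mU.
apply: EFin_inj; rewrite EFinM -!mean_EFin//; last exact: bounded_measurableM.
rewrite -[RHS](ge0_integral_mscale Q measurableT p) //; last first.
  by move=> x _; rewrite lee_fin.
transitivity (\int[P]_(w in U) (EFin \o G \o S) w)%E.
  rewrite [RHS]integral_mkcond; apply: eq_integral => w _.
  rewrite patchE indicE; case: ifPn => wU /=; last by rewrite mul0r.
  by rewrite mul1r.
transitivity (\int[mrestr P mU]_(w in U) (EFin \o G \o S) w)%E.
  by apply: eq_measure_integral => A mA AU; rewrite /= /mrestr (setIidl AU).
(* The complement of [U] is null for the restricted measure. *)
transitivity (\int[mrestr P mU]_w (EFin \o G \o S) w)%E.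
  rewrite [RHS](@ge0_negligible_integral _ _ _ _ _ (~` U)) => //.
  - by rewrite setTD setCK.
  - exact: measurableC.
  - by move=> w _; rewrite lee_fin.
  - by rewrite /= /mrestr setICl measure0.
transitivity (\int[pushforward (mrestr P mU) S]_x (G x)%:E)%E.
  rewrite [RHS](@ge0_integral_pushforward _ _ _ _ _ S mS (mrestr P mU) setT
    (EFin \o G)) //.
  by move=> x _; rewrite lee_fin.
apply: eq_measure_integral => A mA _.
by rewrite /= /pushforward /mrestr /mscale/= setIC US// fineK.
Qed.

Variables (I : finType) (N : Omega -> I).
Hypothesis mN : forall q, measurable (N @^-1` [set q]).
Hypothesis NS : forall q E, measurable E ->
  P ((N @^-1` [set q]) `&` (S @^-1` E)) = (P (N @^-1` [set q]) * Q E)%E.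

(** Splitting along the finitely many values of [N] reduces measurability and means to a fixed
    index. *)
Let sum_fiber (F : I -> W -> R) w :
  F (N w) (S w) = \sum_q \1_(N @^-1` [set q]) w * F q (S w).
Proof.
rewrite (bigD1 (N w))//= indicE mem_set//= mul1r big1 ?addr0// => q qN.
by rewrite indicE memNset ?mul0r//= => /esym/eqP; rewrite (negbTE qN).
Qed.

Lemma bounded_measurable_random_index (F : I -> W -> R) :
  (forall q, bounded_measurable (F q)) ->
  bounded_measurable (fun w => F (N w) (S w)).
Proof.
move=> bF; under eq_fun do rewrite sum_fiber.
apply: bounded_measurable_sum => q; apply: bounded_measurableM.
  exact: bounded_measurable_indic.
exact: bounded_measurable_comp.
Qed.

Lemma mean_random_index (F : I -> W -> R) :
  (forall q, bounded_measurable (F q)) -> (forall q x, 0 <= F q x) ->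
  \int[P]_w F (N w) (S w)
  = \sum_q fine (P (N @^-1` [set q])) * \int[Q]_x F q x.
Proof.
move=> bF F0; under eq_Rintegral do rewrite sum_fiber.
rewrite mean_sum => [|q].
  by apply: eq_bigr => q _; apply: mean_indep => //; exact: NS.
apply: bounded_measurableM; first exact: bounded_measurable_indic.
exact: bounded_measurable_comp.
Qed.

End random_index.

(** * Learning algorithms *)

Section fixed_partition.
Context {R : realType} {dX dY : measure_display}.
Context {X : measurableType dX} {Y : measurableType dY} {Theta : Type}.
Variables (loss : Y -> Y -> R) (A : learning_algorithm X Y Theta)
  (theta : Theta) (n k : nat) (M : R).
Hypothesis n0 : (0 < n)%N.
Hypothesis loss_ge0 : forall y y', 0 <= loss y y'.
Hypothesis mloss : measurable_trained_loss loss A theta n k.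
Hypothesis lossM : is_loss_bound loss A theta n k M.

Definition full_loss (w : n.-tuple (X * Y) * (X * Y)) : R :=
  loss w.2.2 (A theta w.1 w.2.1).

Definition omitted_loss (N : {set 'I_n}) (w : n.-tuple (X * Y) * (X * Y)) : R :=
  loss w.2.2 (A theta (omit_fold w.1 N) w.2.1).

(** Places the size of the reduced training set in [training_sizes], where the loss bound and
    measurability are available. *)
Lemma card_omitted (N : {set 'I_n}) :
  #|N| = (n %/ k)%N -> #|~: N| = (n - n %/ k)%N.
Proof.
move=> <-; have := cardsC N; rewrite card_ord => nE.
by rewrite -[X in (X - _)%N]nE addKn.
Qed.

Lemma full_loss_bounds w : 0 <= full_loss w <= M.
Proof.
by rewrite loss_ge0/=; apply: lossM; rewrite size_tuple !inE eqxx.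
Qed.

Lemma omitted_loss_bounds (N : {set 'I_n}) w : #|N| = (n %/ k)%N ->
  0 <= omitted_loss N w <= M.
Proof.
move=> cN; rewrite loss_ge0/=; apply: lossM.
by rewrite size_map -cardE card_omitted// !inE eqxx orbT.
Qed.

Lemma bounded_measurable_full_loss : bounded_measurable full_loss.
Proof.
split; first by apply: mloss; rewrite !inE eqxx.
by exists M => w; have /andP[? ?] := full_loss_bounds w; rewrite ger0_norm.
Qed.

Lemma bounded_measurable_omitted_loss (N : {set 'I_n}) : #|N| = (n %/ k)%N ->
  bounded_measurable (omitted_loss N).
Proof.
move=> cN; split; last first.
  exists M => w; have /andP[? ?] := omitted_loss_bounds w cN.
  by rewrite ger0_norm.
(* This is [omit_fold] with its length recorded in the type, as [mloss] requires; its measurability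
   is that of a selection of coordinates. *)
pose omit (s : n.-tuple (X * Y)) := [tuple of map (tnth s) (enum_tuple (~: N))].
have momit : measurable_fun [set: n.-tuple (X * Y)] omit.
  apply/measurable_fun_tnthP => i; rewrite /comp.
  by under eq_fun do rewrite tnth_map; exact: measurable_tnth.
have mp : measurable_fun [set: n.-tuple (X * Y) * (X * Y)]
    (fun w : n.-tuple (X * Y) * (X * Y) => (omit w.1, w.2)).
  by apply: measurable_fun_pair => //; exact: measurableT_comp.
have sz : #|~: N| \in training_sizes n k.
  by rewrite card_omitted// !inE eqxx orbT.
exact: (measurableT_comp (mloss sz) mp).
Qed.

Lemma omitted_loss_free (N : {set 'I_n}) :
  free_of N (fun s z => omitted_loss N (s, z)).
Proof.
move=> s s' ss'; apply/funext => z; rewrite /omitted_loss/=.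
congr (loss _ (A _ _ _)); apply/eq_in_map => i.
by rewrite mem_enum inE; exact: ss'.
Qed.

Variables (D : probability (X * Y)%type R)
  (Q : probability (n.-tuple (X * Y)) R).
Hypothesis QD : product_law D Q.
Variable N : {ffun 'I_k -> {set 'I_n}}.
Hypothesis partN : equal_partition N.

Definition cv_gap (s : n.-tuple (X * Y)) : R :=
  \int[D]_z full_loss (s, z)
  - n%:R^-1 * \sum_(j < k) partial_cv_error loss A theta s N j.

Definition fold_instability (j : 'I_k) (s : n.-tuple (X * Y)) : R :=
  \int[D]_z `|omitted_loss (N j) (s, z) - full_loss (s, z)|.

Let cardN j : #|N j| = (n %/ k)%N. Proof. by case: partN. Qed.

Lemma bounded_measurable_cv_gap : bounded_measurable cv_gap.
Proof.
apply: bounded_measurableB.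
  exact: (bounded_measurable_mean1 Q D bounded_measurable_full_loss).
apply: bounded_measurableM; first exact: bounded_measurable_cst.
apply: bounded_measurable_sum => j; apply: bounded_measurable_sum => i.
exact: (bounded_measurable_at i (bounded_measurable_omitted_loss (cardN j))).
Qed.

Lemma bounded_measurable_fold_instability j :
  bounded_measurable (fold_instability j).
Proof.
have bf := bounded_measurable_omitted_loss (cardN j).
have bg := bounded_measurable_full_loss.
have b : bounded_measurable (fun w => `|omitted_loss (N j) w - full_loss w|).
  by bounded_measurable_tac.
exact: (bounded_measurable_mean1 Q D b).
Qed.

Lemma cv_gap_second_moment :
  \int[Q]_s cv_gap s ^+ 2
  <= 3 * M * (k%:R^-1 * \sum_(j < k) \int[Q]_s fold_instability j s)
     + 3 / 8 * M ^+ 2 / k%:R.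
Proof.
have [disjN coverN _] := partN.
(* Covering provides a fold for each point, and disjointness makes it unique. *)
pose fold i := projT1 (cid (coverN i)).
have foldE i j : (fold i == j) = (i \in N j).
  rewrite /fold; case: cid => l /= il; apply/eqP/idP => [<-//|ij].
  apply/eqP; apply: contraTT isT => lj.
  by have /setP/(_ i) := disjN _ _ lj; rewrite !inE il ij.
have foldN j : [set i | fold i == j]%SET = N j.
  by apply/setP => i; rewrite inE foldE.
have := @cross_validation_second_moment _ _ n k (n %/ k) R D Q QD fold
  (fun j => omitted_loss (N j)) full_loss M n0 _ _ _
  bounded_measurable_full_loss _ full_loss_bounds.
have bf j := bounded_measurable_omitted_loss (cardN j).
have bg := bounded_measurable_full_loss.
have -> : \sum_(j < k) \int[Q]_s fold_instability j s = \sum_(j < k)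
    \int[(Q \x D)%E]_w `|omitted_loss (N j) w - full_loss w|.
  by apply: eq_bigr => j _; rewrite mean_product1//; bounded_measurable_tac.
have -> : \int[Q]_s cv_gap s ^+ 2 = \int[Q]_s (\int[D]_z full_loss (s, z)
    - n%:R^-1 * \sum_(i < n) omitted_loss (N (fold i)) (s, tnth s i)) ^+ 2.
  (* The sum over folds and their points becomes a sum over points, each with its own fold. *)
  apply: eq_mean => s; congr ((_ - _ * _) ^+ 2).
  rewrite /partial_cv_error (exchange_big_dep predT)//=; apply: eq_bigr => i _.
  rewrite (eq_bigl (fun j => j == fold i)) ?big_pred1_eq// => j.
  by rewrite -foldE eq_sym.
apply.
- by move=> j; rewrite foldN.
- by move=> j; rewrite foldN; exact: omitted_loss_free.
- by [].
- by move=> j w; exact: omitted_loss_bounds.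
Qed.

End fixed_partition.

(** * From second moment to confidence bound *)

Lemma prob_le_of_second_moment d (T : measurableType d) (R : realType)
    (P : probability T R) (h : T -> R) (V delta : R) : bounded_measurable h ->
  0 < delta -> 0 < V -> \int[P]_w (h w ^+ 2) <= V ->
  ((1 - delta)%:E <= P [set w | (h w <= Num.sqrt (V / delta))%R])%E.
Proof.
move=> bh delta0 V0 hV; set e := Num.sqrt _; set good := [set w | _].
have e2 : e ^+ 2 = V / delta by rewrite sqr_sqrtr// ltW// divr_gt0.
have e0 : 0 <= e by exact: sqrtr_ge0.
have mgood : measurable good.
  rewrite (_ : good = h @^-1` `]-oo, e]%classic); last first.
    by apply/seteqP; split=> w; rewrite /good /= in_itv.
  by rewrite -[X in measurable X]setTI; exact: bh.1.
have mbad := measurableC mgood.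
(* Markov's inequality: on the bad event [h] exceeds the nonnegative [e], so [h ^ 2] is at least
   [V / delta] there. *)
have Pbad : fine (P (~` good)) <= delta.
  rewrite -(ler_pM2l V0) -(@ler_pM2r _ delta^-1) ?invr_gt0// mulfK ?gt_eqF//.
  rewrite mulrAC -e2; apply: le_trans hV.
  have bI := bounded_measurable_indic (R := R) mbad.
  rewrite -mean_indic// -meanZ//; apply: le_mean => [||w].
  - by apply: bounded_measurableM => //; exact: bounded_measurable_cst.
  - exact: bounded_measurableX.
  - rewrite indicE; case: (boolP (w \in _)); last by rewrite mulr0 sqr_ge0.
    rewrite inE /= => /negP; rewrite -ltNge mulr1 => eh.
    by rewrite ler_sqr ?nnegrE// ?ltW// (le_lt_trans e0).
have gfin : P good \is a fin_num by exact: fin_num_measure.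
move: Pbad; rewrite probability_setC// -(fineK gfin) -EFinB/= lee_fin; lra.
Qed.
Theorem theorem2p2 (R : realType) (p n k : nat)
  (hn : (0 < n)%N) (hk : (0 < k)%N) (hkn : (k %| n)%N)
  (X : set (p.-tuple R)) (X0 : X !=set0) (Y : set R) (Y0 : Y !=set0)
  (loss : subspace_of Y0 -> subspace_of Y0 -> R)
  (loss_ge0 : forall y y', 0 <= loss y y')
  (Theta : Type)
  (A : learning_algorithm (subspace_of X0) (subspace_of Y0) Theta)
  (theta : Theta)
  (hA : measurable_trained_loss loss A theta n k)
  (D : probability (subspace_of X0 * subspace_of Y0)%type R)
  (dO : measure_display) (Omega : measurableType dO) (P : probability Omega R)
  (Z : 'I_n -> {mfun Omega >-> (subspace_of X0 * subspace_of Y0)%type})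
  (hZ : iid P D Z)
  (N : Omega -> {ffun 'I_k -> {set 'I_n}})
  (hN : random_equal_partition P Z N)
  (M : R) (hM : is_loss_bound loss A theta n k M)
  (mu_h : R) (hmu : hypothesis_stability loss A theta P D Z N = mu_h%:E)
  (delta : R) (hdelta : 0 < delta < 1) :
  ((1 - delta)%:E <=
   P [set w | ('E_D[fun z => loss z.2 (A theta (sample Z w) z.1)] <=
       (n%:R^-1 * \sum_(j < k) partial_cv_error loss A theta (sample Z w) (N w) j
        + Num.sqrt ((M ^+ 2 + 6 * M * k%:R * mu_h)
                    / (2 * k%:R * delta)))%:E)%E])%E.
Proof.
have [hp mN NS] := hN.
have mS : measurable_fun [set: Omega] (sample Z).
  by apply/measurable_fun_tnthP => i; rewrite /comp;
    under eq_fun do rewrite tnth_mktuple; exact: measurable_funPT.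
pose S : {mfun Omega >-> n.-tuple (subspace_of X0 * subspace_of Y0)} :=
  HB.pack (sample Z) (isMeasurableFun.Build _ _ _ _ _ mS).
pose Q : probability (n.-tuple (subspace_of X0 * subspace_of Y0)) R :=
  distribution P S.
(* Independence over the full index set gives the joint law on boxes. *)
have QD : product_law D Q.
  move=> B mB; have [ZD ZB] := hZ.
  have := ZB finset.setT B mB.
  rewrite (eq_bigr (fun i => D (B i))) => [|i _]; last exact: ZD.
  rewrite (eq_bigl xpredT) => [<-|i]; last by rewrite inE.
  congr (P _); apply/seteqP; split=> w /=.
    by move=> Bw i _; have := Bw i; rewrite tnth_mktuple.
  by move=> Bw i; rewrite tnth_mktuple; apply: Bw; rewrite /= inE.
have NSQ q E : measurable E ->
    P ((N @^-1` [set q]) `&` (sample Z @^-1` E))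
    = (P (N @^-1` [set q]) * Q E)%E by exact: NS.
(* [N] takes only equal partitions as values; for other families of folds the
   losses need not be measurable or bounded. *)
pose gap (q : {ffun 'I_k -> {set 'I_n}}) (s : n.-tuple _) : R :=
  if `[< equal_partition q >]
  then cv_gap loss A theta D q s else 0.
pose inst j (q : {ffun 'I_k -> {set 'I_n}}) (s : n.-tuple _) : R :=
  if `[< equal_partition q >]
  then fold_instability loss A theta D q j s else 0.
have bgap q : bounded_measurable (gap q).
  rewrite /gap; case: asboolP => [pq|_]; last exact: bounded_measurable_cst.
  by have := bounded_measurable_cv_gap loss_ge0 hA hM D Q pq.
have binst j q : bounded_measurable (inst j q).
  rewrite /inst; case: asboolP => [pq|_]; last exact: bounded_measurable_cst.
  by have := bounded_measurable_fold_instability loss_ge0 hA hM D Q pq j.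
have inst_ge0 j q s : 0 <= inst j q s.
  by rewrite /inst; case: asboolP => // _; apply: mean_ge0.
(* Any one loss lies between [0] and [M]; it is evaluated at the default points. *)
have M0 : 0 <= M.
  have /andP[] := full_loss_bounds loss_ge0 hM (point, point).
  exact: le_trans.
have kR0 : 0 < k%:R :> R by rewrite ltr0n.
have gapNE w :
    gap (N w) (sample Z w) = cv_gap loss A theta D (N w) (sample Z w).
  by rewrite /gap asboolT.
have bgapN : bounded_measurable (fun w => gap (N w) (sample Z w)).
  exact: bounded_measurable_random_index.
have binstN j : bounded_measurable (fun w => inst j (N w) (sample Z w)).
  exact: bounded_measurable_random_index.
(* The left side is the term of index [j] in the maximum that defines [mu_h]. *)
have inst_le j : \int[P]_w inst j (N w) (sample Z w) <= mu_h.
  rewrite -lee_fin -mean_EFin// -hmu.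
  apply: le_trans (le_bigmax _ _ j).
  rewrite le_eqVlt; apply/orP; left; apply/eqP.
  apply: eq_integral => w _; rewrite /inst asboolT// -mean_EFin//.
  have [_ _ cardN] := hp w.
  have bf := bounded_measurable_omitted_loss loss_ge0 hA hM (cardN j).
  have bg := bounded_measurable_full_loss loss_ge0 hA hM.
  apply: bounded_measurable_norm; apply: bounded_measurableB.
    exact: bounded_measurable_section1 bf _.
  exact: bounded_measurable_section1 bg _.
have mu0 : 0 <= mu_h.
  by apply: le_trans (inst_le (Ordinal hk)); exact: mean_ge0.
have moment : \int[P]_w gap (N w) (sample Z w) ^+ 2
    <= 3 * M * mu_h + 3 / 8 * M ^+ 2 / k%:R.
  pose c := 3 * M * k%:R^-1; pose c' := 3 / 8 * M ^+ 2 / k%:R.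
  have c0 : 0 <= c by rewrite !mulr_ge0// invr_ge0.
  have c'0 : 0 <= c' by rewrite !mulr_ge0// ?invr_ge0// exprn_ge0.
  pose bound q s := c * (\sum_(j < k) inst j q s) + c'.
  have bs q : bounded_measurable (fun s => \sum_(j < k) inst j q s).
    exact: bounded_measurable_sum.
  have bbound q : bounded_measurable (bound q).
    by rewrite /bound; bounded_measurable_tac.
  have bgap2 q : bounded_measurable (fun s => gap q s ^+ 2).
    exact: bounded_measurableX.
  have bound_ge0 q s : 0 <= bound q s.
    by rewrite addr_ge0// mulr_ge0//; exact: sumr_ge0.
  have gap2_ge0 q s : 0 <= gap q s ^+ 2 by exact: sqr_ge0.
  (* Conditioning on the partition: the fixed-partition bound is applied to each value [q], and the
     results are reassembled into a mean under [P], where [inst_le] can be used. *)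
  rewrite (mean_random_index mS mN NSQ bgap2 gap2_ge0).
  apply: (@le_trans _ _ (\int[P]_w bound (N w) (sample Z w))).
    rewrite (mean_random_index mS mN NSQ bbound bound_ge0).
    apply: ler_sum => q _; apply: ler_wpM2l; first exact: fine_ge0.
    have -> : \int[Q]_s bound q s
        = c * (\sum_(j < k) \int[Q]_s inst j q s) + c'.
      by rewrite meanD ?meanZ ?mean_cst ?mean_sum//; bounded_measurable_tac.
    rewrite /gap /inst; case: asboolP => [pq|_].
      rewrite /c -[_ * _ * _]mulrA.
      by have := cv_gap_second_moment hn loss_ge0 hA hM QD pq.
    (* Off the equal partitions [gap] and [inst] vanish, and [c'] is nonnegative. *)
    rewrite big1 => [|j _]; last exact: mean_cst.
    by rewrite mulr0 add0r expr0n mean_cst.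
  have bsN : bounded_measurable
      (fun w => \sum_(j < k) inst j (N w) (sample Z w)).
    exact: bounded_measurable_sum.
  rewrite meanD ?meanZ ?mean_cst ?mean_sum//; try by bounded_measurable_tac.
  rewrite lerD2r; apply: (@le_trans _ _ (c * \sum_(j < k) mu_h)).
    by apply: ler_wpM2l => //; apply: ler_sum.
  by rewrite sumr_const card_ord -[mu_h *+ k]mulr_natl /c mulrA mulfVK ?gt_eqF.
have cv_ge0 w : 0 <= n%:R^-1 *
    \sum_(j < k) partial_cv_error loss A theta (sample Z w) (N w) j.
  by rewrite mulr_ge0// ?invr_ge0//; do 2 apply: sumr_ge0 => ? _.
have riskE w : ('E_D[fun z => loss z.2 (A theta (sample Z w) z.1)]
    = (\int[D]_z full_loss loss A theta (sample Z w, z))%:E)%E.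
  rewrite unlock -mean_EFin//.
  have bg := bounded_measurable_full_loss loss_ge0 hA hM.
  by have := bounded_measurable_section1 bg (sample Z w).
pose V := (M ^+ 2 + 6 * M * k%:R * mu_h) / (2 * k%:R).
have -> : (M ^+ 2 + 6 * M * k%:R * mu_h) / (2 * k%:R * delta) = V / delta.
  by rewrite /V invfM mulrA.
rewrite [X in P X](_ : _ =
    [set w | (gap (N w) (sample Z w) <= Num.sqrt (V / delta))%R]); last first.
  by apply/seteqP; split=> w /=; rewrite riskE lee_fin gapNE /cv_gap lerBlDl.
have /andP[delta0 _] := hdelta.
(* If [M] is zero, [V] vanishes and the Markov bound does not apply; but then the risk is at most
   zero, and the event is the whole space. *)
have [M_gt0|M_le0] := ltP 0 M; last first.
  rewrite [X in P X](_ : _ = setT) ?probability_setT ?lee_fin ?gerBl ?ltW//.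
  apply/seteqP; split=> // w _ /=; rewrite gapNE.
  apply: le_trans (sqrtr_ge0 _); rewrite subr_le0; apply: le_trans (cv_ge0 w).
  apply: le_trans M_le0; rewrite -[leRHS](mean_cst D).
  have bg := bounded_measurable_full_loss loss_ge0 hA hM.
  apply: le_mean => [||z].
  - by have := bounded_measurable_section1 bg (sample Z w).
  - exact: bounded_measurable_cst.
  - by have /andP[] := full_loss_bounds loss_ge0 hM (sample Z w, z).
have V0 : 0 < V.
  rewrite divr_gt0// ?mulr_gt0// ltr_pwDl ?exprn_gt0//.
  by rewrite !mulr_ge0// ltW.
apply: prob_le_of_second_moment => //.
apply: le_trans moment _.
have -> : V = 3 * M * mu_h + M ^+ 2 / (2 * k%:R).
  by rewrite /V; field; rewrite gt_eqF.
(* What remains is [3 / 8 <= 1 / 2] in front of [M ^ 2 / k]. *)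
rewrite lerD2l [leRHS](_ : _ = 2^-1 * M ^+ 2 / k%:R); last first.
  by field; rewrite gt_eqF.
rewrite ler_wpM2r ?invr_ge0// ler_wpM2r ?exprn_ge0//.
by clear -R; lra.
Qed.
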